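(* Let $(I,\delta_1,\delta_2)$ and $(I,\sigma_1,\sigma_2)$ be two distinct (i.e. $\sigma_1\neq\delta_1$) regular P-configurations in $I=[-1,1]$. Let $h:I\to I$ be the unique homeomorphism such that $h(-1)=-1$, $h(0)=0$, $h(1)=1$ and $h(\delta_i(t))=\sigma_i(h(t))$ for $i=1,2$ and all $t\in I$. Then $h$ is not continuously differentiable on $I$.
   Context: Let $I=[-1,1]$. Two $C^1$ maps $\delta_1,\delta_2:I\to I$ form a P-configuration in $I$ if $\delta_1(t)+\delta_2(t)=t$ for all $t\in I$; $\delta_i'(t)\ge 0$ for all $t\in I$, $i=1,2$; and $\delta_2(-1)=-1$, $\delta_2(1)=\delta_1(-1)=0$, $\delta_1(1)=1$. The P-configuration is called regular if both guiding sets $\Lambda_i=\{t\in I:\delta_i'(t)=0\}$, $i=1,2$, are empty, i.e. $\delta_1'(t)>0$ and $\delta_2'(t)>0$ for all $t\in I$; it is then denoted $(I,\delta_1,\delta_2)$. For any two regular P-configurations, a homeomorphism $h$ as in the claim exists and is unique. *)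

(* Defs.v *)
From Stdlib Require Import Reals.
Open Scope R_scope.

(* Maps I -> I are represented by total functions R -> R of which only the
   values on I matter: every notion below is relative to I, so continuity and
   derivatives are one-sided at -1 and 1. *)
Definition Itv (t : R) : Prop := -1 <= t <= 1.

Definition maps_Itv (f : R -> R) : Prop := forall t, Itv t -> Itv (f t).

Definition continuous_on_Itv (f : R -> R) : Prop :=
  forall t, Itv t -> continue_in f Itv t.

(* [f'(t) = l].  [D_in f d D t] only uses the value [d t], hence the constant
   function; [l] is unique since every point of I is a limit point of I. *)
Definition has_deriv (f : R -> R) (t l : R) : Prop :=
  D_in f (fun _ => l) Itv t.

Definition C1_on_Itv (f : R -> R) : Prop :=
  exists f' : R -> R,
    (forall t, Itv t -> has_deriv f t (f' t)) /\ continuous_on_Itv f'.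

Record P_configuration (d1 d2 : R -> R) : Prop := {
  Pc_maps1 : maps_Itv d1;
  Pc_maps2 : maps_Itv d2;
  Pc_C1_1 : C1_on_Itv d1;
  Pc_C1_2 : C1_on_Itv d2;
  Pc_sum : forall t, Itv t -> d1 t + d2 t = t;
  Pc_nonneg1 : forall t l, Itv t -> has_deriv d1 t l -> 0 <= l;
  Pc_nonneg2 : forall t l, Itv t -> has_deriv d2 t l -> 0 <= l;
  Pc_d2_m1 : d2 (-1) = -1;
  Pc_d2_1 : d2 1 = 0;
  Pc_d1_m1 : d1 (-1) = 0;
  Pc_d1_1 : d1 1 = 1
}.

Definition guiding_set (d : R -> R) (t : R) : Prop :=
  Itv t /\ has_deriv d t 0.

Definition regular_P_configuration (d1 d2 : R -> R) : Prop :=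
  P_configuration d1 d2 /\
  (forall t, ~ guiding_set d1 t) /\ (forall t, ~ guiding_set d2 t).

Definition homeomorphism_Itv (h : R -> R) : Prop :=
  maps_Itv h /\ continuous_on_Itv h /\
  exists g : R -> R,
    maps_Itv g /\ continuous_on_Itv g /\
    (forall t, Itv t -> g (h t) = t) /\ (forall t, Itv t -> h (g t) = t).

Definition conjugating_homeomorphism (d1 d2 s1 s2 h : R -> R) : Prop :=
  homeomorphism_Itv h /\
  h (-1) = -1 /\ h 0 = 0 /\ h 1 = 1 /\
  (forall t, Itv t -> h (d1 t) = s1 (h t)) /\
  (forall t, Itv t -> h (d2 t) = s2 (h t)).

(* Main.v *)
Require Import Defs.
From Stdlib Require Import Reals.
From Stdlib Require Import Lra.
From Coquelicot Require Import Coquelicot.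
Open Scope R_scope.

(** The conjugacy equations and the identities [delta1 + delta2 = id],
    [sigma1 + sigma2 = id] give [h t = h (delta1 t) + h (delta2 t)] on [I].
    If [h] is C^1, differentiating yields

      [h' t = delta1' t * h' (delta1 t) + delta2' t * h' (delta2 t)],

    where the weights are positive (regularity) and add up to 1
    ([deriv_harmonic]).  So [h'] obeys a maximum principle
    ([harmonic_le_endpoint]): if [h'] is maximal at [t], it is maximal at
    [delta1 t] too, and since [delta1] moves every point of [I] other than 1
    strictly to the right, the rightmost maximum point can only be 1.  The same
    applied to [- h'] shows that the minimum is also [h' 1].  Hence [h'] is
    constant, [h] is affine, the boundary values force [h = id], and the
    conjugacy then says [sigma1 = delta1]. *)

(** * Calculus on the interval with one-sided derivatives *)

(** The retraction of the line onto [I]: composing with it turns functions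
    controlled on [I] only into functions on the line, to which the two-sided
    theorems of real analysis apply. *)
Definition clamp (x : R) : R := Rmax (-1) (Rmin 1 x).

Lemma clamp_Itv x : Itv (clamp x).
Proof.
  unfold clamp, Itv, Rmax, Rmin.
  repeat destruct (Rle_dec _ _); lra.
Qed.

Lemma clamp_id x : Itv x -> clamp x = x.
Proof.
  unfold clamp, Itv, Rmax, Rmin.
  repeat destruct (Rle_dec _ _); lra.
Qed.

Lemma clamp_contract x y : Rabs (clamp x - clamp y) <= Rabs (x - y).
Proof.
  unfold clamp, Rmax, Rmin, Rabs.
  repeat destruct (Rle_dec _ _); repeat destruct (Rcase_abs _); lra.
Qed.

Lemma continuous_on_Itv_eps f t eps :
  continuous_on_Itv f -> Itv t -> 0 < eps ->
  exists alp, 0 < alp /\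
    forall x, Itv x -> Rabs (x - t) < alp -> Rabs (f x - f t) < eps.
Proof.
  intros Hf Ht Heps.
  destruct (Hf t Ht eps Heps) as [alp [Halp Hx]].
  exists alp; split; [exact Halp|].
  intros x HxI Hd.
  destruct (Req_dec t x) as [E|N].
  - subst x. replace (f t - f t) with 0 by ring. now rewrite Rabs_R0.
  - apply (Hx x). split; [split|]; assumption.
Qed.

Lemma continuity_clamp f :
  continuous_on_Itv f -> continuity (fun x => f (clamp x)).
Proof.
  intros Hf x eps Heps.
  destruct (continuous_on_Itv_eps f (clamp x) eps Hf (clamp_Itv x) Heps)
    as [alp [Halp Hx]].
  exists alp; split; [exact Halp|].
  intros y [_ Hd]. apply Hx; [apply clamp_Itv|].
  eapply Rle_lt_trans; [apply clamp_contract|exact Hd].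
Qed.

Lemma has_deriv_continuous f f' :
  (forall t, Itv t -> has_deriv f t (f' t)) -> continuous_on_Itv f.
Proof.
  intros Hf t Ht. exact (cont_deriv f _ Itv t (Hf t Ht)).
Qed.

(** At an interior point the relative derivative is the ordinary one, because
    small enough increments stay in [I]. *)
Lemma has_deriv_interior f t l :
  -1 < t < 1 -> has_deriv f t l -> is_derive (fun x => f (clamp x)) t l.
Proof.
  intros Ht Hf. apply is_derive_Reals.
  intros eps Heps.
  destruct (Hf eps Heps) as [alp [Halp Hx]].
  assert (Hd : 0 < Rmin alp (Rmin (1 - t) (t + 1))).
  { repeat apply Rmin_glb_lt; lra. }
  exists (mkposreal _ Hd). intros k Hk Hkd. simpl in Hkd.
  pose proof (Rmin_l alp (Rmin (1 - t) (t + 1))).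
  pose proof (Rmin_r alp (Rmin (1 - t) (t + 1))).
  pose proof (Rmin_l (1 - t) (t + 1)).
  pose proof (Rmin_r (1 - t) (t + 1)).
  assert (HI : Itv (t + k)).
  { pose proof (Rle_abs k). pose proof (Rle_abs (- k)).
    rewrite Rabs_Ropp in *. unfold Itv; lra. }
  rewrite (clamp_id _ HI), (clamp_id t) by (unfold Itv; lra).
  specialize (Hx (t + k)). simpl in Hx. unfold Rdist in Hx.
  replace (t + k - t) with k in Hx by ring.
  apply Hx. split; [split; [exact HI|lra]|lra].
Qed.

Lemma has_deriv_MVT f f' a b :
  (forall t, Itv t -> has_deriv f t (f' t)) -> Itv a -> Itv b ->
  exists c, Itv c /\ f b - f a = f' c * (b - a).
Proof.
  intros Hf Ha Hb.
  assert (Hsub : forall x, Rmin a b <= x <= Rmax a b -> Itv x).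
  { unfold Itv in *. intros x Hx.
    pose proof (Rmin_glb a b (-1)). pose proof (Rmax_lub a b 1). lra. }
  destruct (MVT_gen (fun x => f (clamp x)) a b f') as [c [Hc E]].
  - intros x Hx. apply has_deriv_interior.
    + unfold Itv in *.
      pose proof (Rmin_glb a b (-1)). pose proof (Rmax_lub a b 1). lra.
    + apply Hf, Hsub; lra.
  - intros x _. apply continuity_clamp. now apply has_deriv_continuous with f'.
  - exists c. split; [now apply Hsub|].
    now rewrite (clamp_id a Ha), (clamp_id b Hb) in E.
Qed.

Lemma Itv_adherent t : Itv t -> adhDa (D_x Itv t) t.
Proof.
  intros Ht alp Halp. unfold D_x, Itv, Rdist in *.
  pose proof (Rmin_l (alp / 2) (1 / 2)). pose proof (Rmin_r (alp / 2) (1 / 2)).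
  assert (0 < Rmin (alp / 2) (1 / 2)) by (apply Rmin_glb_lt; lra).
  set (m := Rmin (alp / 2) (1 / 2)) in *.
  (* step towards the centre of the interval, so as not to leave it *)
  destruct (Rle_dec t 0).
  - exists (t + m). split; [lra|].
    replace (t + m - t) with m by ring. rewrite Rabs_pos_eq; lra.
  - exists (t - m). split; [lra|].
    replace (t - m - t) with (- m) by ring.
    rewrite Rabs_Ropp, Rabs_pos_eq; lra.
Qed.

Lemma has_deriv_unique f t l l' :
  Itv t -> has_deriv f t l -> has_deriv f t l' -> l = l'.
Proof.
  intros Ht. apply single_limit. now apply Itv_adherent.
Qed.

Lemma has_deriv_ext f g t l :
  (forall x, Itv x -> f x = g x) -> Itv t -> has_deriv f t l ->
  has_deriv g t l.
Proof.
  intros E Ht Hf eps Heps.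
  destruct (Hf eps Heps) as [alp [Halp Hx]].
  exists alp; split; [exact Halp|].
  intros x HxD. rewrite <- (E t Ht), <- (E x) by apply HxD.
  now apply Hx.
Qed.

Lemma has_deriv_plus f g t l m :
  has_deriv f t l -> has_deriv g t m ->
  has_deriv (fun x => f x + g x) t (l + m).
Proof. apply Dadd. Qed.

Lemma has_deriv_comp f g t l m :
  maps_Itv f -> has_deriv f t l -> has_deriv g (f t) m ->
  has_deriv (fun x => g (f x)) t (l * m).
Proof.
  intros Hmap Hf Hg.
  apply limit1_imp with (D := D_x (Dgf Itv Itv f) t).
  - intros x [HI Hne]. repeat split; [| |apply Hmap|apply Hmap|]; trivial; apply HI.
  - exact (Dcomp Itv Itv (fun _ => l) (fun _ => m) f g t Hf Hg).
Qed.

(** * Consequences of regularity *)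

Lemma regular_deriv_pos d1 d2 t :
  regular_P_configuration d1 d2 -> Itv t ->
  forall l1 l2, has_deriv d1 t l1 -> has_deriv d2 t l2 ->
  0 < l1 /\ 0 < l2 /\ l1 + l2 = 1.
Proof.
  intros [HP [Hg1 Hg2]] Ht l1 l2 H1 H2.
  assert (l1 <> 0) by (intros ->; apply (Hg1 t); split; assumption).
  assert (l2 <> 0) by (intros ->; apply (Hg2 t); split; assumption).
  pose proof (Pc_nonneg1 _ _ HP t l1 Ht H1).
  pose proof (Pc_nonneg2 _ _ HP t l2 Ht H2).
  repeat split; [lra|lra|].
  apply (has_deriv_unique (fun x => x) t); [exact Ht| |apply Dx].
  apply has_deriv_ext with (fun x => d1 x + d2 x); trivial.
  - apply (Pc_sum _ _ HP).
  - now apply has_deriv_plus.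
Qed.

(** [d2] is strictly increasing with [d2 1 = 0], so [d1 t - t = - d2 t] is
    positive before 1: iterating [d1] pushes every point to the right end. *)
Lemma regular_d1_gt d1 d2 t :
  regular_P_configuration d1 d2 -> Itv t -> t < 1 -> t < d1 t.
Proof.
  intros Hreg Ht Hlt.
  pose proof (proj1 Hreg) as HP.
  destruct (Pc_C1_1 _ _ HP) as [d1' [H1 _]].
  destruct (Pc_C1_2 _ _ HP) as [d2' [H2 _]].
  destruct (has_deriv_MVT d2 d2' t 1 H2 Ht) as [c [Hc E]].
  { unfold Itv; lra. }
  destruct (regular_deriv_pos d1 d2 c Hreg Hc _ _ (H1 c Hc) (H2 c Hc))
    as [_ [Hpos _]].
  rewrite (Pc_d2_1 _ _ HP) in E.
  pose proof (Pc_sum _ _ HP t Ht).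
  pose proof (Rmult_lt_0_compat (d2' c) (1 - t) Hpos). lra.
Qed.

(** * The maximum principle *)

(** The level set is closed and bounded, so its supremum belongs to it. *)
Lemma level_set_last u t0 :
  continuous_on_Itv u -> Itv t0 ->
  exists T, Itv T /\ u T = u t0 /\ forall t, Itv t -> u t = u t0 -> t <= T.
Proof.
  intros Hu Ht0.
  destruct (completeness (fun t => Itv t /\ u t = u t0)) as [T [Hub Hlub]].
  - exists 1. intros t [[_ H] _]. exact H.
  - exists t0. now split.
  - assert (HT : Itv T).
    { split.
      - pose proof (Hub t0 (conj Ht0 eq_refl)). unfold Itv in Ht0. lra.
      - apply Hlub. intros t [[_ H] _]. exact H. }
    exists T. split; [exact HT|]. split; [|intros t H E; now apply Hub].
    destruct (Req_dec (u T) (u t0)) as [E|N]; [exact E|exfalso].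
    destruct (continuous_on_Itv_eps u T (Rabs (u t0 - u T)) Hu HT)
      as [alp [Halp Hx]].
    { apply Rabs_pos_lt. lra. }
    (* otherwise the level set would avoid a whole neighbourhood of its supremum *)
    assert (T <= T - alp); [|lra].
    apply Hlub. intros t [HtI Et].
    destruct (Rle_dec t (T - alp)) as [|Hgt]; [assumption|exfalso].
    pose proof (Hub t (conj HtI Et)).
    assert (Hlt : Rabs (u t - u T) < Rabs (u t0 - u T)).
    { apply Hx; [exact HtI|].
      rewrite Rabs_left1; lra. }
    rewrite Et in Hlt. lra.
Qed.

(** At the last maximum point [T], the averaging identity makes [d1 T] a maximum
    point as well; being last, [T] must satisfy [d1 T <= T], that is [T = 1]. *)
Lemma harmonic_le_endpoint d1 d2 a b u :
  maps_Itv d1 -> maps_Itv d2 ->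
  (forall t, Itv t -> t < 1 -> t < d1 t) ->
  (forall t, Itv t -> 0 < a t /\ 0 < b t /\ a t + b t = 1) ->
  continuous_on_Itv u ->
  (forall t, Itv t -> u t = a t * u (d1 t) + b t * u (d2 t)) ->
  forall t, Itv t -> u t <= u 1.
Proof.
  intros Hm1 Hm2 Hgt Hab Hu Hharm.
  destruct (continuity_ab_maj (fun x => u (clamp x)) (-1) 1) as [t0 [Hmax Ht0]].
  { lra. }
  { intros c _. now apply continuity_clamp. }
  assert (HM : forall t, Itv t -> u t <= u t0).
  { intros t Ht. specialize (Hmax t Ht).
    now rewrite (clamp_id t Ht), (clamp_id t0 Ht0) in Hmax. }
  destruct (level_set_last u t0 Hu Ht0) as [T [HT [ET Hlast]]].
  assert (E1 : u (d1 T) = u t0).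
  { destruct (Hab T HT) as [Ha [Hb Hs]].
    pose proof (HM _ (Hm1 T HT)) as L1. pose proof (HM _ (Hm2 T HT)) as L2.
    pose proof (Hharm T HT) as E. rewrite ET in E.
    apply Rle_antisym; [exact L1|].
    apply Rmult_le_reg_l with (a T); [exact Ha|].
    pose proof (Rmult_le_compat_l (b T) _ _ (Rlt_le _ _ Hb) L2).
    replace (b T) with (1 - a T) in * by lra. lra. }
  assert (T = 1) as ->.
  { destruct (Rlt_dec T 1) as [Hlt|]; [exfalso|unfold Itv in HT; lra].
    pose proof (Hgt T HT Hlt). pose proof (Hlast _ (Hm1 T HT) E1). lra. }
  rewrite ET. exact HM.
Qed.

Lemma continuous_on_Itv_opp u :
  continuous_on_Itv u -> continuous_on_Itv (fun t => - u t).
Proof. intros Hu t Ht. apply limit_Ropp, Hu, Ht. Qed.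

Lemma harmonic_constant d1 d2 a b u :
  maps_Itv d1 -> maps_Itv d2 ->
  (forall t, Itv t -> t < 1 -> t < d1 t) ->
  (forall t, Itv t -> 0 < a t /\ 0 < b t /\ a t + b t = 1) ->
  continuous_on_Itv u ->
  (forall t, Itv t -> u t = a t * u (d1 t) + b t * u (d2 t)) ->
  forall t, Itv t -> u t = u 1.
Proof.
  intros Hm1 Hm2 Hgt Hab Hu Hharm t Ht. apply Rle_antisym.
  - now apply (harmonic_le_endpoint d1 d2 a b u).
  - assert (- u t <= - u 1); [|lra].
    apply (harmonic_le_endpoint d1 d2 a b (fun t => - u t)); trivial.
    + now apply continuous_on_Itv_opp.
    + intros s Hs. rewrite (Hharm s Hs). ring.
Qed.

(** * Rigidity of differentiable conjugacies *)

(** Summing the two conjugacy equations eliminates [s1] and [s2], and the result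
    is linear in [h], hence can be differentiated term by term. *)
Lemma conjugacy_additive d1 d2 s1 s2 h t :
  P_configuration s1 s2 -> conjugating_homeomorphism d1 d2 s1 s2 h ->
  Itv t -> h (d1 t) + h (d2 t) = h t.
Proof.
  intros Hs [[Hmap _] [_ [_ [_ [E1 E2]]]]] Ht.
  rewrite (E1 t Ht), (E2 t Ht). apply (Pc_sum _ _ Hs), Hmap, Ht.
Qed.

Lemma deriv_harmonic d1 d2 d1' d2' h h' t :
  maps_Itv d1 -> maps_Itv d2 ->
  (forall x, Itv x -> has_deriv d1 x (d1' x)) ->
  (forall x, Itv x -> has_deriv d2 x (d2' x)) ->
  (forall x, Itv x -> has_deriv h x (h' x)) ->
  (forall x, Itv x -> h (d1 x) + h (d2 x) = h x) ->
  Itv t -> h' t = d1' t * h' (d1 t) + d2' t * h' (d2 t).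
Proof.
  intros Hm1 Hm2 H1 H2 Hh Hadd Ht.
  apply (has_deriv_unique h t); [exact Ht|now apply Hh|].
  apply has_deriv_ext with (fun x => h (d1 x) + h (d2 x)); trivial.
  apply has_deriv_plus; apply has_deriv_comp; auto.
Qed.

Theorem proposition4p1 (delta1 delta2 sigma1 sigma2 : R -> R)
  (Hdelta : regular_P_configuration delta1 delta2)
  (Hsigma : regular_P_configuration sigma1 sigma2)
  (Hdistinct : ~ (forall t : R, Itv t -> sigma1 t = delta1 t))
  (h : R -> R)
  (Hh : conjugating_homeomorphism delta1 delta2 sigma1 sigma2 h) :
  ~ C1_on_Itv h.
Proof.
  intros [h' [Hder Hcont]]. apply Hdistinct.
  pose proof (proj1 Hdelta) as HP.
  destruct (Pc_C1_1 _ _ HP) as [d1' [H1 _]].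
  destruct (Pc_C1_2 _ _ HP) as [d2' [H2 _]].
  pose proof (Pc_maps1 _ _ HP) as Hm1. pose proof (Pc_maps2 _ _ HP) as Hm2.
  assert (Hconst : forall t, Itv t -> h' t = h' 1).
  { apply (harmonic_constant delta1 delta2 d1' d2'); trivial.
    - intros t. exact (regular_d1_gt delta1 delta2 t Hdelta).
    - intros t Ht. apply (regular_deriv_pos delta1 delta2 t); auto.
    - intros t Ht. apply deriv_harmonic with h; trivial.
      intros x. apply conjugacy_additive with sigma1 sigma2; [apply Hsigma|exact Hh]. }
  destruct Hh as [_ [Hhm1 [_ [Hh1 [Hconj _]]]]].
  assert (Im1 : Itv (-1)) by (unfold Itv; lra).
  assert (I1 : Itv 1) by (unfold Itv; lra).
  assert (Haff : forall t, Itv t -> h t + 1 = h' 1 * (t + 1)).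
  { intros t Ht.
    destruct (has_deriv_MVT h h' (-1) t Hder Im1 Ht) as [c [Hc E]].
    rewrite (Hconst c Hc), Hhm1 in E. lra. }
  assert (Hslope : h' 1 = 1) by (pose proof (Haff 1 I1); lra).
  assert (Hid : forall t, Itv t -> h t = t).
  { intros t Ht. pose proof (Haff t Ht). rewrite Hslope in *. lra. }
  intros t Ht.
  rewrite <- (Hid t Ht) at 1. rewrite <- (Hconj t Ht).
  apply Hid, Hm1, Ht.
Qed.
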